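(* Let $\kappa$ be a regular infinite cardinal. If $\mathfrak{r}_\kappa<\mathfrak{d}_\kappa$ then $\mathfrak{r}_\kappa=\mathfrak{u}_\kappa$. Consequently, $\mathfrak{r}_\kappa<\mathfrak{d}_\kappa$ implies $\operatorname{cf}(\mathfrak{r}_\kappa)>\omega$.
   Context: A set $S\in[\kappa]^\kappa$ splits $B\in[\kappa]^\kappa$ if $|S\cap B|=|B\setminus S|=\kappa$. The reaping number $\mathfrak{r}_\kappa$ is the minimal cardinality of a family $\mathcal{A}\subseteq[\kappa]^\kappa$ such that no single $S\in[\kappa]^\kappa$ splits every member of $\mathcal{A}$. An ultrafilter over $\kappa$ is uniform if all its elements have size $\kappa$; a base of an ultrafilter $\mathscr{U}$ is $\mathcal{B}\subseteq\mathscr{U}$ such that every element of $\mathscr{U}$ contains an element of $\mathcal{B}$; $\mathfrak{u}_\kappa$ is the minimal cardinality of a base of a uniform ultrafilter over $\kappa$. For $f,g\in{}^\kappa\kappa$, $f\le^* g$ means $|\{\beta<\kappa:f(\beta)>g(\beta)\}|<\kappa$; $\mathfrak{d}_\kappa$ is the minimal cardinality of a family $\mathcal{D}\subseteq{}^\kappa\kappa$ such that every $f\in{}^\kappa\kappa$ satisfies $f\le^* g$ for some $g\in\mathcal{D}$. *)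

(* Defs.v *)
From Stdlib Require Import Classical.

Definition card_le {T U : Type} (X : T -> Prop) (Y : U -> Prop) : Prop :=
  exists f : T -> U,
    (forall x, X x -> Y (f x)) /\
    (forall x y, X x -> X y -> f x = f y -> x = y).

Definition card_lt {T U : Type} (X : T -> Prop) (Y : U -> Prop) : Prop :=
  card_le X Y /\ ~ card_le Y X.

Definition full (T : Type) : T -> Prop := fun _ => True.

Definition wo_on {T : Type} (X : T -> Prop) (R : T -> T -> Prop) : Prop :=
  (forall x, X x -> ~ R x x) /\
  (forall x y z, X x -> X y -> X z -> R x y -> R y z -> R x z) /\
  (forall x y, X x -> X y -> R x y \/ x = y \/ R y x) /\
  (forall Y : T -> Prop, (forall y, Y y -> X y) -> (exists y, Y y) ->
     exists m, Y m /\ forall y, Y y -> ~ R y m).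

(* The cardinal |X| has uncountable cofinality: well-ordering X in order
   type |X| (every proper initial segment has cardinality < |X|),
   no countable subset of X is cofinal. *)
Definition cf_gt_omega {T : Type} (X : T -> Prop) : Prop :=
  exists R : T -> T -> Prop,
    wo_on X R /\
    (forall a, X a -> card_lt (fun x => X x /\ R x a) X) /\
    (forall s : nat -> T, (forall n, X (s n)) ->
       exists a, X a /\ forall n, R (s n) a).

(* (K, lt) is (the von Neumann ordinal of) a regular infinite cardinal:
   a well-order, infinite, every proper initial segment has smaller
   cardinality (initial ordinal), and every unbounded subset has size kappa. *)
Definition regular_infinite_cardinal (K : Type) (lt : K -> K -> Prop) : Prop :=
  wo_on (full K) lt /\
  card_le (full nat) (full K) /\
  (forall a : K, card_lt (fun x => lt x a) (full K)) /\
  (forall C : K -> Prop, (forall a, exists c, C c /\ ~ lt c a) ->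
     card_le (full K) C).

Section Kappa.
Context {K : Type} (lt : K -> K -> Prop).

Definition large (X : K -> Prop) : Prop := card_le (full K) X.

Definition splits (S B : K -> Prop) : Prop :=
  large (fun x => S x /\ B x) /\ large (fun x => B x /\ ~ S x).

Definition unsplit (A : (K -> Prop) -> Prop) : Prop :=
  (forall B, A B -> large B) /\
  ~ (exists S, large S /\ forall B, A B -> splits S B).

(* |A| = r_kappa *)
Definition reaping_witness (A : (K -> Prop) -> Prop) : Prop :=
  unsplit A /\ forall A', unsplit A' -> card_le A A'.

Definition ultrafilter (U : (K -> Prop) -> Prop) : Prop :=
  (forall X Y, U X -> (forall x, X x -> Y x) -> U Y) /\
  (forall X Y, U X -> U Y -> U (fun x => X x /\ Y x)) /\
  ~ U (fun _ => False) /\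
  (forall X, U X \/ U (fun x => ~ X x)).

Definition uniform_ultrafilter (U : (K -> Prop) -> Prop) : Prop :=
  ultrafilter U /\ forall X, U X -> large X.

Definition base_of (U B : (K -> Prop) -> Prop) : Prop :=
  (forall X, B X -> U X) /\
  (forall X, U X -> exists Y, B Y /\ forall x, Y x -> X x).

Definition le_star (f g : K -> K) : Prop :=
  card_lt (fun b => lt (g b) (f b)) (full K).

Definition dominating (D : (K -> K) -> Prop) : Prop :=
  forall f, exists g, D g /\ le_star f g.

End Kappa.

(* Main.v *)
From Stdlib Require Import Classical ClassicalEpsilon FunctionalExtensionality.
From Stdlib Require Import List Arith Lia Cantor.
From mathcomp Require boolp wochoice.
Require Import Defs.
Import ListNotations.

(** Suppose [|A| = r < d], with [A] unsplit. For [X], [B] in [A] let [B_X] be the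
    copy of [B] inside [X] under a fixed injection of [K] into [X]; the sets
    [B_X] are unsplit within [X]. There are only [r] functions sending [b] to a
    point beyond the next elements after [b] of finitely many sets [B_X], so
    some [f] is not dominated by any of them. Cut [K] into intervals so long
    that [[b, f b)] never meets more than two consecutive ones, and colour the
    intervals alternately. Some [X] in [A] lies almost entirely in one colour,
    so any finitely many sets [B_X] have points in a common interval,
    unboundedly often: collapsing each interval to a point turns the sets [B_X]
    into a family generating a uniform ultrafilter, with a base of size [r].
    Conversely a base of a uniform ultrafilter is unsplit.

    The cofinality statement holds because an ultrafilter is never the union of
    a strictly increasing sequence of filters, so its character has uncountable
    cofinality. *)

(** * Well-orders and recursion along them *)

Definition wellorder {T : Type} (W : T -> T -> Prop) : Prop :=
  well_founded W /\
  (forall x y z, W x y -> W y z -> W x z) /\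
  (forall x y, x = y \/ W x y \/ W y x).

Lemma wf_of_least {T : Type} (W : T -> T -> Prop) :
  (forall P : T -> Prop, (exists x, P x) ->
     exists m, P m /\ forall y, P y -> ~ W y m) ->
  well_founded W.
Proof.
  intros hmin a. apply NNPP; intros ha.
  destruct (hmin (fun x => ~ Acc W x) (ex_intro _ a ha)) as [m [hm hm']].
  apply hm; constructor; intros y hy. apply NNPP; intros hy'.
  exact (hm' y hy' hy).
Qed.

Lemma wf_least {T : Type} (W : T -> T -> Prop) (hW : well_founded W)
  (P : T -> Prop) :
  (exists x, P x) -> exists m, P m /\ forall y, P y -> ~ W y m.
Proof.
  intros [x hx]. apply NNPP; intros hno. revert hx.
  induction (hW x) as [x _ IH]; intros hx.
  apply hno; exists x; split; [exact hx|].
  intros y hy hyx. exact (IH y hyx hy).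
Qed.

Lemma wf_irrefl {T : Type} (W : T -> T -> Prop) :
  well_founded W -> forall x, ~ W x x.
Proof.
  intros hW x. induction (hW x) as [x _ IH]. intros h; exact (IH x h h).
Qed.

(** Least elements of sets of one, two and three points make the relation [R] reflexive,
    antisymmetric, total and transitive; its strict part is the order. *)
Lemma well_ordering (T : Type) : exists W : T -> T -> Prop, wellorder W.
Proof.
  destruct (wochoice.well_ordering_principle 
    (boolp.boolp_classicType__canonical__eqtype_Equality T))
    as [R hR].
  assert (hmin : forall P : T -> Prop, (exists x, P x) ->
    exists m, P m /\ (forall y, P y -> R m y = true) /\
      forall m', P m' -> (forall y, P y -> R m' y = true) -> m = m').
  { intros P [x hx].
    set (A := fun z : T => boolp.asbool (P z)).
    assert (hA : forall z, A z = true <-> P z).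
    { intros z; split; intros h.
      - exact (ssrbool.elimT (boolp.asboolP (P z)) h).
      - exact (ssrbool.introT (boolp.asboolP (P z)) h). }
    destruct (hR A) as [m [[hm1 hm2] hm3]].
    { exists x. apply hA, hx. }
    exists m; split; [apply hA, hm1|split].
    - intros y hy. apply hm2. apply hA, hy.
    - intros m' h1 h2. apply hm3. split; [apply hA, h1|].
      intros y hy. apply h2, hA, hy. }
  assert (hrefl : forall x, R x x = true).
  { intros x. destruct (hmin (fun z => z = x)) as [m [-> [h _]]]; eauto. }
  assert (hanti : forall x y, R x y = true -> R y x = true -> x = y).
  { intros x y hxy hyx.
    destruct (hmin (fun z => z = x \/ z = y)) as [m [_ [_ h]]]; [eauto|].
    rewrite <- (h x), <- (h y); auto; intros z [-> | ->]; auto. }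
  assert (htot : forall x y, R x y = true \/ R y x = true).
  { intros x y.
    destruct (hmin (fun z => z = x \/ z = y)) as [m [hm [h _]]]; [eauto|].
    destruct hm as [-> | ->]; auto. }
  exists (fun x y => R x y = true /\ x <> y). split; [|split].
  - apply wf_of_least. intros P hP.
    destruct (hmin P hP) as [m [hm [h _]]]. exists m; split; [exact hm|].
    intros y hy [hym hne]. apply hne, hanti; auto.
  - intros x y z [hxy nxy] [hyz nyz].
    destruct (hmin (fun t => t = x \/ t = y \/ t = z)) as [m [hm [h _]]];
      [eauto|].
    assert (m = x) as ->.
    { destruct hm as [-> | [-> | ->]]; auto.
      - apply hanti; auto.
      - exfalso; apply nyz, hanti; auto. }
    split; [auto|]. intros ->. apply nxy, hanti; auto.
  - intros x y. destruct (classic (x = y)) as [|hne]; [auto|right].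
    destruct (htot x y); [left|right]; split; auto.
Qed.

(** Recursion with choice: the value at [a] is picked among those permitted by the values already
    chosen below it. *)
Lemma wf_choice {T U : Type} (W : T -> T -> Prop) (hW : well_founded W)
  (hU : inhabited U) (P : forall a, (forall b, W b a -> U) -> U -> Prop) :
  exists n : T -> U, forall a,
    (exists y, P a (fun b _ => n b) y) -> P a (fun b _ => n b) (n a).
Proof.
  set (F := fun a (g : forall b, W b a -> U) => epsilon hU (P a g)).
  exists (Fix hW (fun _ => U) F). intros a hex.
  rewrite Fix_eq.
  - apply epsilon_spec, hex.
  - intros x g g' hg. f_equal.
    apply functional_extensionality_dep; intros b.
    apply functional_extensionality_dep; intros h. apply hg.
Qed.

(** * Cardinalities *)

Lemma card_le_trans {T U V : Type} (X : T -> Prop) (Y : U -> Prop)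
  (Z : V -> Prop) : card_le X Y -> card_le Y Z -> card_le X Z.
Proof.
  intros [f [f1 f2]] [g [g1 g2]]. exists (fun x => g (f x)); split; auto.
Qed.

Lemma card_le_sub {T : Type} (X Y : T -> Prop) :
  (forall x, X x -> Y x) -> card_le X Y.
Proof. intros h. exists (fun x => x); auto. Qed.

Lemma card_le_surj {T U : Type} (X : T -> Prop) (Y : U -> Prop) (f : T -> U) :
  inhabited T -> (forall y, Y y -> exists x, X x /\ f x = y) -> card_le Y X.
Proof.
  intros hT hf. set (P := fun y x => X x /\ f x = y).
  assert (hP : forall y, Y y -> P y (epsilon hT (P y))).
  { intros y hy. apply epsilon_spec, hf, hy. }
  exists (fun y => epsilon hT (P y)); split.
  - intros y hy. apply hP, hy.
  - intros y y' hy hy' e. destruct (hP y hy) as [_ <-].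
    destruct (hP y' hy') as [_ <-]. rewrite e; reflexivity.
Qed.

Lemma card_le_of_segments {T U : Type} (W : T -> T -> Prop) (X : T -> Prop)
  (Y : U -> Prop) :
  wellorder W -> inhabited U ->
  (forall x, X x -> ~ card_le Y (fun z => X z /\ W z x)) -> card_le X Y.
Proof.
  intros [hwf [_ htot]] hU hseg.
  destruct (wf_choice W hwf hU
    (fun a g y => Y y /\ forall b h, X b -> g b h <> y)) as [j hj].
  assert (hj' : forall a, X a -> Y (j a) /\ forall b, W b a -> X b -> j b <> j a).
  { intros a ha. apply hj. apply NNPP; intros hno.
    apply (hseg a ha). apply (card_le_surj _ _ j (inhabits a)).
    intros y hy. apply NNPP; intros hno'. apply hno. exists y; split; auto.
    intros b hb hXb e. apply hno'. exists b; auto. }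
  exists j; split.
  - intros x hx; apply hj', hx.
  - intros x y hx hy e. destruct (htot x y) as [|[h|h]]; [auto|exfalso..].
    + apply (proj2 (hj' y hy) x h hx e).
    + apply (proj2 (hj' x hx) y h hy); auto.
Qed.

Lemma card_le_total {T U : Type} (X : T -> Prop) (Y : U -> Prop) :
  inhabited U -> card_le X Y \/ card_le Y X.
Proof.
  intros hU. destruct (well_ordering T) as [W hW].
  destruct (classic (card_le Y X)) as [h|h]; [auto|left].
  apply (card_le_of_segments W); auto.
  intros x _ hx. apply h, (card_le_trans _ _ _ hx), card_le_sub. tauto.
Qed.

(** Finiteness; the list may also contain points outside [X]. *)
Definition listed {T : Type} (X : T -> Prop) : Prop :=
  exists l, forall x, X x -> In x l.

Lemma listed_le {T U : Type} (X : T -> Prop) (Y : U -> Prop) :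
  card_le X Y -> listed Y -> listed X.
Proof.
  intros [f [f1 f2]] [l hl].
  destruct (classic (exists x : T, X x)) as [[x0 _]|hno].
  2: { exists nil; intros x hx. exfalso; eauto. }
  exists (map (fun y => epsilon (inhabits x0) (fun x => X x /\ f x = y)) l).
  intros x hx. apply in_map_iff. exists (f x); split; auto.
  destruct (epsilon_spec (inhabits x0) (fun x' => X x' /\ f x' = f x)) as [h1 h2].
  - eauto.
  - apply f2; auto.
Qed.

Lemma nat_not_listed : ~ listed (full nat).
Proof.
  intros [l hl]. specialize (hl (S (list_max l)) I).
  assert (h := proj1 (list_max_le l (list_max l)) (le_n _)).
  rewrite Forall_forall in h. specialize (h _ hl). lia.
Qed.

Lemma infinite_or_listed {T : Type} (X : T -> Prop) :
  card_le (full nat) X \/ listed X.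
Proof.
  destruct (classic (listed X)) as [h|h]; [auto|left].
  assert (hT : inhabited T).
  { apply NNPP; intros hT. apply h. exists nil. intros x; destruct hT; exact (inhabits x). }
  apply (card_le_of_segments lt); auto.
  - split; [exact Wf_nat.lt_wf|split; intros; lia].
  - intros n _ hn. apply h, (listed_le _ _ hn).
    exists (seq 0 n). intros k [_ hk]. apply in_seq; lia.
Qed.

(** Hilbert's hotel: a new point [p] goes to [s 0], each [s n] to [s (S n)], and all else stays. *)
Lemma card_le_add_point {T : Type} (X : T -> Prop) (p : T) :
  card_le (full nat) X -> card_le (fun x => X x \/ x = p) X.
Proof.
  intros [s [s1 s2]].
  destruct (classic (X p)) as [hp|hp].
  { apply card_le_sub. intros x [h| ->]; auto. }
  set (P := fun x y => (x = p /\ y = s 0) \/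
    (x <> p /\ exists n, x = s n /\ y = s (S n)) \/
    (x <> p /\ (forall n, x <> s n) /\ y = x)).
  assert (hP : forall x, exists y, P x y).
  { intros x. destruct (classic (x = p)) as [e|e].
    - exists (s 0). left; auto.
    - destruct (classic (exists n, x = s n)) as [[n hn]|hn].
      + exists (s (S n)). right; left; eauto.
      + exists x. right; right; repeat split; auto. intros n hn'; eauto. }
  set (f := fun x => epsilon (inhabits p) (P x)).
  assert (hf : forall x, P x (f x)) by (intros x; apply epsilon_spec, hP).
  assert (hs : forall n m, s n = s m -> n = m).
  { intros n m; apply s2; exact I. }
  exists f; split.
  - intros x hx. destruct (hf x) as [[_ ->]|[[_ [n [_ ->]]]|[h [_ ->]]]].
    + apply s1; exact I.
    + apply s1; exact I.
    + tauto.
  - intros x y _ _ e.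
    destruct (hf x) as [[hx hx']|[[hx [n [hx1 hx2]]]|[hx [hx1 hx2]]]];
    destruct (hf y) as [[hy hy']|[[hy [m [hy1 hy2]]]|[hy [hy1 hy2]]]];
    try congruence.
    + assert (h : 0 = S m) by (apply hs; congruence). discriminate.
    + assert (h : S n = 0) by (apply hs; congruence). discriminate.
    + assert (h : S n = S m) by (apply hs; congruence). congruence.
Qed.

(** * Squares, finite lists and orders of minimal type *)

Definition square {T : Type} (X : T -> Prop) (p : T * T) : Prop :=
  X (fst p) /\ X (snd p).

Lemma square_le {T U : Type} (X : T -> Prop) (Y : U -> Prop) :
  card_le X Y -> card_le (square X) (square Y).
Proof.
  intros [f [f1 f2]]. exists (fun p => (f (fst p), f (snd p))); split.
  - intros [a b] [ha hb]; split; simpl; auto.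
  - intros [a b] [c d] [ha hb] [hc hd]; simpl in *. intros e. inversion e.
    f_equal; apply f2; auto.
Qed.

(* Pairs are ordered by their maximum first, so that the predecessors of a
   pair lie in the square of a proper initial segment. *)
Lemma square_le_of_segments {T : Type} (W : T -> T -> Prop) (X : T -> Prop) :
  wellorder W ->
  (forall b, X b -> forall Y : T -> Prop, (forall y, Y y -> W y b) ->
     card_le (full nat) Y -> card_le (square Y) Y) ->
  card_le (full nat) X -> card_le (square X) X.
Proof.
  intros hW IH hinf. pose proof hW as [hwf [htr htot]].
  assert (hirr := wf_irrefl W hwf).
  assert (hT : inhabited T) by (destruct hinf as [s _]; exact (inhabits (s 0))).
  (* If [X] embeds in one of its proper segments, the hypothesis for that segment suffices;
     afterwards all proper segments are smaller than [X]. *)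
  destruct (classic (exists b, X b /\ card_le X (fun x => X x /\ W x b)))
    as [[b [hb hXb]]|hseg].
  { apply (card_le_trans _ _ _ (square_le _ _ hXb)).
    apply (card_le_trans _ (fun x => X x /\ W x b)).
    - apply (IH b hb); [tauto|]. exact (card_le_trans _ _ _ hinf hXb).
    - apply card_le_sub; tauto. }
  destruct (well_ordering (T * T)) as [V [hV1 [hV2 hV3]]].
  assert (hmax : forall p : T * T, exists m, (m = fst p \/ m = snd p) /\
    ~ W m (fst p) /\ ~ W m (snd p)).
  { intros [a b]; simpl. destruct (htot a b) as [->|[h|h]].
    - exists b; auto.
    - exists b; repeat split; auto. intros h'. exact (hirr _ (htr _ _ _ h h')).
    - exists a; repeat split; auto. intros h'. exact (hirr _ (htr _ _ _ h h')). }
  set (M := fun p : T * T => epsilon hT (fun m => (m = fst p \/ m = snd p) /\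
    ~ W m (fst p) /\ ~ W m (snd p))).
  assert (hM : forall p, (M p = fst p \/ M p = snd p) /\
    ~ W (M p) (fst p) /\ ~ W (M p) (snd p)).
  { intros p. apply (epsilon_spec hT), hmax. }
  clearbody M.
  apply (card_le_of_segments
    (fun p q => W (M p) (M q) \/ (M p = M q /\ V p q))); auto.
  - split; [|split].
    + intros p. remember (M p) as m eqn:e. revert p e.
      induction (hwf m) as [m _ IHm]. intros p.
      induction (hV1 p) as [p _ IHp]. intros e.
      constructor. intros q [h|[h1 h2]].
      * apply (IHm (M q)); [congruence|reflexivity].
      * apply IHp; [exact h2|congruence].
    + intros p q r [h|[h1 h2]] [h'|[h1' h2']].
      * left; eapply htr; eauto.
      * left; congruence.
      * left; congruence.
      * right; split; [congruence|eapply hV2; eauto].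
    + intros p q. destruct (htot (M p) (M q)) as [e|[h|h]]; [|auto..].
      destruct (hV3 p q) as [|[h|h]]; auto.
  (* The predecessors of [p] lie in the square of [Y] with [m] added. For infinite [Y] this embeds
     [X] in a proper segment; for finite [Y] it makes [X] finite. *)
  - intros p [hp1 hp2] hle. set (m := M p) in *.
    assert (hm : X m) by (destruct (hM p) as [[e|e] _]; unfold m; congruence).
    set (Y := fun x => X x /\ W x m).
    assert (hle' : card_le X (square (fun x => Y x \/ x = m))).
    { apply (card_le_trans _ _ _ hle), card_le_sub.
      intros q [[hq1 hq2] hq].
      assert (hq' : ~ W m (M q)).
      { intros h. destruct hq as [h'|[h' _]].
        - exact (hirr _ (htr _ _ _ h h')).
        - unfold m in h; rewrite h' in h; exact (hirr _ h). }
      assert (hx : forall x, X x -> ~ W (M q) x -> Y x \/ x = m).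
      { intros x hx1 hx2. destruct (htot x m) as [|[h|h]]; [auto|left;split;auto|].
        exfalso. destruct (htot m (M q)) as [e|[h'|h']]; [congruence|auto|].
        apply hx2; eapply htr; eauto. }
      destruct (hM q) as [_ [h1 h2]]. split; apply hx; auto. }
    destruct (infinite_or_listed Y) as [hY|[l hl]].
    + apply hseg. exists m; split; [exact hm|].
      apply (card_le_trans _ _ _ hle').
      apply (card_le_trans _ _ _ (square_le _ _ (card_le_add_point Y m hY))).
      apply (IH m hm); [unfold Y; tauto|exact hY].
    + apply nat_not_listed.
      apply (listed_le _ _ (card_le_trans _ _ _ hinf hle')).
      exists (list_prod (m :: l) (m :: l)). intros [a b] [ha hb].
      simpl fst in ha; simpl snd in hb.
      apply in_prod; [destruct ha|destruct hb]; simpl; auto.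
Qed.

(** Induction on a strict bound settles bounded sets; one more application of the segment lemma
    settles the rest. *)
Lemma card_le_square {T : Type} (X : T -> Prop) :
  card_le (full nat) X -> card_le (square X) X.
Proof.
  destruct (well_ordering T) as [W hW].
  assert (hb : forall b (Y : T -> Prop), (forall y, Y y -> W y b) ->
    card_le (full nat) Y -> card_le (square Y) Y).
  { intros b. induction (proj1 hW b) as [b _ IH]. intros Y hY.
    apply (square_le_of_segments W Y hW).
    intros b' hb'. exact (IH b' (hY b' hb')). }
  apply (square_le_of_segments W X hW). intros b _; exact (hb b).
Qed.

Lemma card_le_lists {T : Type} (X : T -> Prop) :
  card_le (full nat) X -> card_le (Forall X) X.
Proof.
  intros hinf. destruct (card_le_square X hinf) as [p [p1 p2]].
  destruct hinf as [s [s1 s2]].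
  assert (hs : forall n, X (s n)) by (intros; apply s1; exact I).
  assert (hp : forall a b, X a -> X b -> X (p (a, b))).
  { intros a b ha hb. apply p1; split; auto. }
  assert (hpi : forall a b c d, X a -> X b -> X c -> X d ->
    p (a, b) = p (c, d) -> a = c /\ b = d).
  { intros a b c d ha hb hc hd e. apply p2 in e; [|split; auto..].
    inversion e; auto. }
  (* The tags [s 0] and [s 1] tell the empty list from a nonempty one. *)
  set (code := fold_right (fun x y => p (s 1, p (x, y))) (p (s 0, s 0))).
  assert (hc : forall l, Forall X l -> X (code l)).
  { induction 1; simpl; auto. }
  assert (h01 : s 0 <> s 1).
  { intros e. apply s2 in e; try exact I. discriminate. }
  exists code; split; [exact hc|].
  intros l l' hl. revert l'.
  induction hl as [|x l hx hl IH]; intros l' hl' e; destruct hl' as [|x' l' hx' hl'].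
  - reflexivity.
  - simpl in e. apply hpi in e; auto. tauto.
  - simpl in e. apply hpi in e; auto. destruct e; congruence.
  - simpl in e. apply hpi in e; auto. destruct e as [_ e].
    apply hpi in e; auto. destruct e as [-> e]. f_equal; auto.
Qed.

Lemma card_le_lists_mono {T U : Type} (X : T -> Prop) (Y : U -> Prop) :
  card_le X Y -> card_le (Forall X) (Forall Y).
Proof.
  intros [f [f1 f2]]. exists (map f); split.
  - induction 1; simpl; auto.
  - intros l l' hl. revert l'.
    induction hl as [|x l hx hl IH]; intros l' hl' e;
      destruct hl' as [|x' l' hx' hl']; try discriminate; [reflexivity|].
    simpl in e; inversion e. f_equal; auto.
Qed.

(** Take the least [b] such that [X] embeds by some [j] in its part below [b], and pull the order
    back along [j]: a segment as large as [X] would give a smaller [b]. If there is no such [b], the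
    order itself works. *)
Lemma initial_wo {T : Type} (X : T -> Prop) :
  exists R : T -> T -> Prop, wo_on X R /\
    forall a, X a -> ~ card_le X (fun x => X x /\ R x a).
Proof.
  destruct (well_ordering T) as [W [hwf [htr htot]]].
  assert (hirr := wf_irrefl W hwf).
  assert (hj : exists j : T -> T, (forall x, X x -> X (j x)) /\
    (forall x y, X x -> X y -> j x = j y -> x = y) /\
    forall a, X a -> ~ card_le X (fun x => X x /\ W x (j a))).
  { destruct (classic (exists b, card_le X (fun x => X x /\ W x b))) as [hb|hb].
    - destruct (wf_least W hwf _ hb) as [b [[j [j1 j2]] hb']].
      exists j; split; [intros; apply j1; auto|split; [exact j2|]].
      intros a ha h.
      apply (hb' (j a) h). apply j1, ha.
    - exists (fun x => x); split; [auto|split; [auto|]]. intros a _ h; eauto. }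
  destruct hj as [j [j0 [j1 j2]]].
  exists (fun x y => W (j x) (j y)); split.
  - split; [|split; [|split]].
    + intros x _; apply hirr.
    + intros x y z _ _ _; apply htr.
    + intros x y hx hy. destruct (htot (j x) (j y)) as [e|[h|h]]; auto.
    + intros Y hY [y hy].
      destruct (wf_least W hwf (fun z => exists y, Y y /\ z = j y))
        as [m [[y' [h1 ->]] h2]]; [eauto|].
      exists y'; split; [exact h1|]. intros z hz; apply h2; eauto.
  - intros a ha h. apply (j2 a ha), (card_le_trans _ _ _ h).
    exists j; split.
    + intros x [hx hxa]; split; auto.
    + intros x y [hx _] [hy _]; auto.
Qed.

(** * Bounded sets and interval blocks of a regular cardinal *)

Lemma regular_wellorder {K : Type} (lt : K -> K -> Prop) :
  regular_infinite_cardinal K lt -> wellorder lt.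
Proof.
  intros [[hirr [htr [htot hmin]]] _]. split; [|split].
  - apply wf_of_least. intros P hP. apply hmin; [intros; exact I|exact hP].
  - intros x y z; apply htr; exact I.
  - intros x y. destruct (htot x y I I) as [|[]]; auto.
Qed.

Lemma regular_inhabited {K : Type} (lt : K -> K -> Prop) :
  regular_infinite_cardinal K lt -> inhabited K.
Proof. intros [_ [[s _] _]]. exact (inhabits (s 0)). Qed.

Lemma wellorder_le_lt_trans {T : Type} (W : T -> T -> Prop) (hW : wellorder W)
  x y z : ~ W y x -> W y z -> W x z.
Proof.
  destruct hW as [_ [htr htot]]. intros h h'.
  destruct (htot x y) as [->|[|]]; [auto|eauto|tauto].
Qed.

Lemma wellorder_lt_le_trans {T : Type} (W : T -> T -> Prop) (hW : wellorder W)
  x y z : W x y -> ~ W z y -> W x z.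
Proof.
  destruct hW as [_ [htr htot]]. intros h h'.
  destruct (htot y z) as [<-|[|]]; [auto|eauto|tauto].
Qed.

Lemma wellorder_le_trans {T : Type} (W : T -> T -> Prop) (hW : wellorder W)
  x y z : ~ W y x -> ~ W z y -> ~ W z x.
Proof.
  intros h1 h2 h. apply h2, (wellorder_lt_le_trans W hW _ x); auto.
Qed.

Lemma wellorder_le_antisym {T : Type} (W : T -> T -> Prop) (hW : wellorder W)
  x y : ~ W x y -> ~ W y x -> x = y.
Proof.
  destruct hW as [_ [_ htot]]. destruct (htot x y) as [|[]]; tauto.
Qed.

Lemma wellorder_lt_le {T : Type} (W : T -> T -> Prop) (hW : wellorder W)
  x y : W x y -> ~ W y x.
Proof.
  destruct hW as [hwf [htr _]]. intros h h'.
  exact (wf_irrefl W hwf _ (htr _ _ _ h h')).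
Qed.

Lemma wellorder_max {T : Type} (W : T -> T -> Prop) (hW : wellorder W)
  x y : exists m, ~ W m x /\ ~ W m y.
Proof.
  assert (hirr := wf_irrefl W (proj1 hW)).
  destruct (classic (W x y)) as [h|h].
  - exists y; split; [apply wellorder_lt_le|]; auto.
  - exists x; auto.
Qed.

Lemma unbounded_of_large {K : Type} (lt : K -> K -> Prop) :
  regular_infinite_cardinal K lt ->
  forall X : K -> Prop, large X -> forall a, exists x, X x /\ ~ lt x a.
Proof.
  intros [_ [_ [hseg _]]] X hX a. apply NNPP; intros hno.
  apply (proj2 (hseg a)), (card_le_trans _ _ _ hX), card_le_sub.
  intros x hx. apply NNPP; intros h; eauto.
Qed.

Lemma large_of_unbounded {K : Type} (lt : K -> K -> Prop) :
  regular_infinite_cardinal K lt ->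
  forall X : K -> Prop, (forall a, exists x, X x /\ ~ lt x a) -> large X.
Proof. intros [_ [_ [_ h]]]; exact h. Qed.

Lemma bounded_of_not_large {K : Type} (lt : K -> K -> Prop) :
  regular_infinite_cardinal K lt ->
  forall X : K -> Prop, ~ large X -> exists a, forall x, X x -> lt x a.
Proof.
  intros hK X hX. apply NNPP; intros hno. apply hX.
  apply (large_of_unbounded lt hK). intros a. apply NNPP; intros h.
  apply hno. exists a. intros x hx. apply NNPP; intros h'; eauto.
Qed.

(** The usual form of regularity: fewer than $\kappa$ values have a strict bound. *)
Lemma bounded_image {K : Type} (lt : K -> K -> Prop) :
  regular_infinite_cardinal K lt ->
  forall (I : Type) (P : I -> Prop) (f : I -> K), ~ card_le (full K) P ->
  exists a, forall i, P i -> lt (f i) a.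
Proof.
  intros hK I P f hP.
  destruct (bounded_of_not_large lt hK (fun y => exists i, P i /\ f i = y))
    as [a ha].
  - intros hl. apply hP, (card_le_trans _ _ _ hl).
    destruct (regular_inhabited lt hK) as [k].
    destruct (unbounded_of_large lt hK _ hl k) as [_ [[i _] _]].
    apply (card_le_surj _ _ f (inhabits i)). auto.
  - exists a. eauto.
Qed.

Lemma listed_not_large {K : Type} (lt : K -> K -> Prop) :
  regular_infinite_cardinal K lt ->
  forall (I : Type) (P : I -> Prop), listed P -> ~ card_le (full K) P.
Proof.
  intros [_ [hnat _]] I P hP h.
  exact (nat_not_listed (listed_le _ _ (card_le_trans _ _ _ hnat h) hP)).
Qed.

Lemma regular_no_max {K : Type} (lt : K -> K -> Prop) :
  regular_infinite_cardinal K lt -> forall a, exists b, lt a b.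
Proof.
  intros hK a.
  destruct (bounded_image lt hK unit (fun _ => True) (fun _ => a)) as [b hb].
  - apply (listed_not_large lt hK). exists [tt]. intros [] _; left; auto.
  - exists b. exact (hb tt Logic.I).
Qed.

(** Colours are chosen recursively and flipped at each [s b]. Monotonicity makes [s] injective, so
    no point receives two conflicting demands. *)
Lemma alternating_colouring {K : Type} (lt : K -> K -> Prop) (hW : wellorder lt)
  (s : K -> K) :
  (forall a, lt a (s a)) -> (forall a b, lt a b -> lt (s a) (s b)) ->
  exists c : K -> bool, forall a, c (s a) = negb (c a).
Proof.
  intros hs hmono. pose proof hW as [hwf [_ htot]].
  assert (hirr := wf_irrefl lt hwf).
  destruct (wf_choice lt hwf (inhabits true)
    (fun a g v => forall b h, a = s b -> v = negb (g b h))) as [c hc].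
  exists c. intros a. refine (hc (s a) _ a (hs a) eq_refl).
  exists (negb (c a)). intros b _ e. do 2 f_equal.
  destruct (htot a b) as [|[h|h]]; [auto|exfalso..];
    apply hmono in h; rewrite e in h; exact (hirr _ h).
Qed.

(* [idx z] numbers the interval of [K] containing [z], in a partition fast
   enough that [[b, f b)] meets at most two consecutive intervals, and [c]
   colours consecutive intervals differently. *)
Lemma interval_blocks {K : Type} (lt : K -> K -> Prop)
  (hK : regular_infinite_cardinal K lt) (f : K -> K) :
  exists (idx : K -> K) (c : K -> bool),
    (forall x y, ~ lt y x -> ~ lt (idx y) (idx x)) /\
    (forall a, exists z, forall z', ~ lt z' z -> lt a (idx z')) /\
    (forall b z z', ~ lt z b -> lt z (f b) -> ~ lt z' b -> lt z' (f b) ->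
       c (idx z) = c (idx z') -> idx z = idx z') /\
    (forall v d, exists b, ~ lt b d /\ c (idx b) = v /\
       forall z, ~ lt z b -> lt z (f b) -> c (idx z) = v).
Proof.
  assert (hW := regular_wellorder lt hK). pose proof hW as [hwf [htr htot]].
  assert (hirr := wf_irrefl lt hwf).
  assert (le_lt := wellorder_le_lt_trans lt hW).
  assert (lt_le := wellorder_lt_le_trans lt hW).
  assert (le_le := wellorder_le_trans lt hW).
  assert (lt_w := wellorder_lt_le lt hW).
  assert (hsmall : forall a, ~ card_le (full K) (fun x => lt x a)).
  { intros a. exact (proj2 (proj1 (proj2 (proj2 hK)) a)). }
  assert (hsucc : forall a, exists b, lt a b /\ forall y, lt a y -> ~ lt y b).
  { intros a. apply (wf_least lt hwf), (regular_no_max lt hK). }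
  destruct (choice _ hsucc) as [s hs]. clear hsucc.
  assert (hs_mono : forall a b, lt a b -> lt (s a) (s b)).
  { intros a b h. apply (le_lt _ b); [apply hs, h|apply hs]. }
  destruct (alternating_colouring lt hW s) as [c hc];
    [intros; apply hs|exact hs_mono|].
  (* [F x] is the least point beyond [x] that bounds [f b] for every [b] up to [x]; leastness makes
     [F] monotone. *)
  assert (hF : forall x, exists y,
    (lt x y /\ forall b, ~ lt x b -> ~ lt y (f b)) /\
    forall y', (lt x y' /\ forall b, ~ lt x b -> ~ lt y' (f b)) -> ~ lt y' y).
  { intros x. apply (wf_least lt hwf).
    destruct (bounded_image lt hK K (fun b => lt b (s x)) f) as [y hy].
    { apply hsmall. }
    destruct (wellorder_max lt hW y (s x)) as [m [hm1 hm2]].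
    exists m; split.
    - apply (lt_le _ (s x)); [apply hs|auto].
    - intros b hb. apply (le_le _ y); [|auto]. apply lt_w, hy.
      apply (le_lt _ x); [auto|apply hs]. }
  destruct (choice _ hF) as [F hF']. clear hF.
  assert (F_gt : forall x, lt x (F x)) by (intros; apply hF').
  assert (F_ge : forall x, ~ lt (F x) (f x)) by (intros; apply hF'; auto).
  assert (F_mono : forall x y, ~ lt y x -> ~ lt (F y) (F x)).
  { intros x y h. apply hF'. split.
    - apply (le_lt _ y); auto.
    - intros b hb. apply hF'. apply (le_le _ x); auto. }
  (* [n a] is the left end of the interval with index [a]: the supremum of the right ends [F (n b)]
     of all earlier ones. *)
  destruct (wf_choice lt hwf (regular_inhabited lt hK)
    (fun a g y => (forall b h, ~ lt y (F (g b h))) /\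
       forall y', (forall b h, ~ lt y' (F (g b h))) -> ~ lt y' y)) as [n hn].
  assert (hn' : forall a, (forall b, lt b a -> ~ lt (n a) (F (n b))) /\
       forall y', (forall b, lt b a -> ~ lt y' (F (n b))) -> ~ lt y' (n a)).
  { intros a. apply hn. apply (wf_least lt hwf).
    destruct (bounded_image lt hK K (fun b => lt b a) (fun b => F (n b)))
      as [y hy]; [apply hsmall|].
    exists y. intros b h. apply lt_w, hy, h. }
  clear hn.
  assert (n_lt : forall a b, lt b a -> ~ lt (n a) (F (n b))) by (intros a; apply hn').
  assert (n_mono : forall a b, ~ lt a b -> ~ lt (n a) (n b)).
  { intros a b h. destruct (htot a b) as [->|[h'|h']]; [auto|tauto|].
    apply (le_le _ (F (n b))); auto. }
  assert (n_ge : forall a, ~ lt (n a) a).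
  { intros a. induction (hwf a) as [a _ IH]. intros h.
    apply (n_lt a (n a) h). apply (le_lt _ (n (n a))); auto. }
  assert (hidx : forall z, exists a, lt z (F (n a)) /\
    forall a', lt z (F (n a')) -> ~ lt a' a).
  { intros z. apply (wf_least lt hwf). exists z. apply (le_lt _ (n z)); auto. }
  destruct (choice _ hidx) as [idx hi]. clear hidx.
  assert (idx_mono : forall x y, ~ lt y x -> ~ lt (idx y) (idx x)).
  { intros x y h. apply hi. apply (le_lt _ y); [auto|apply hi]. }
  exists idx, c. split; [exact idx_mono|split; [|split]].
  - intros a. exists (F (n a)). intros z hz.
    destruct (htot a (idx z)) as [e|[h|h]]; [exfalso|auto|exfalso].
    + apply hz. rewrite e. apply hi.
    + apply hz. apply (lt_le _ (F (n (idx z)))); [apply hi|]. auto.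
  - intros b. set (a := idx b).
    (* As [b] lies below [F (n a)], the value [f b] is at most [F (n (s a))], the end of the next
       interval. *)
    assert (hz : forall z, ~ lt z b -> lt z (f b) -> idx z = a \/ idx z = s a).
    { intros z h1 h2.
      assert (h3 : ~ lt (idx z) a) by (apply idx_mono, h1).
      assert (h4 : ~ lt (s a) (idx z)).
      { apply hi. apply (lt_le _ (f b)); [exact h2|].
        apply (le_le _ (F b)); [apply F_ge|]. apply F_mono.
        apply (le_le _ (F (n a))).
        - apply lt_w, hi.
        - apply n_lt, hs. }
      destruct (htot (idx z) a) as [|[|h]]; [auto|tauto|right].
      apply (wellorder_le_antisym lt hW); [apply hs, h|exact h4]. }
    intros z z' h1 h2 h3 h4.
    destruct (hz z h1 h2) as [-> | ->], (hz z' h3 h4) as [-> | ->]; auto;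
      rewrite hc; destruct (c a); discriminate.
  - intros v d.
    (* One of [d] and [s d] has colour [v]. A window starting at the left end [n a] of that interval
       stays inside it, since [f (n a)] is at most [F (n a)]. *)
    assert (ha : exists a, ~ lt a d /\ c a = v).
    { destruct (Bool.bool_dec (c d) v) as [e|e].
      - exists d; auto.
      - exists (s d); split; [apply lt_w, hs|]. rewrite hc.
        destruct (c d), v; simpl; congruence. }
    destruct ha as [a [h1 h2]].
    assert (h : forall z, ~ lt z (n a) -> lt z (F (n a)) -> c (idx z) = v).
    { intros z hz1 hz2. replace (idx z) with a; [exact h2|].
      apply (wellorder_le_antisym lt hW); [apply hi, hz2|].
      intros h. apply hz1. apply (lt_le _ (F (n (idx z)))); [apply hi|].
      apply n_lt, h. }
    exists (n a); split; [apply (le_le _ a); auto|split].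
    + apply h; auto.
    + intros z hz1 hz2. apply h; [auto|]. apply (lt_le _ (f (n a))); auto.
Qed.

Lemma next_element {K : Type} (lt : K -> K -> Prop)
  (hK : regular_infinite_cardinal K lt) :
  exists next : (K -> Prop) -> K -> K, forall X, large X -> forall a,
    X (next X a) /\ ~ lt (next X a) a.
Proof.
  apply (choice (fun X (g : K -> K) => large X -> forall a, X (g a) /\ ~ lt (g a) a)).
  intros X. destruct (classic (large X)) as [h|h].
  - destruct (choice _ (unbounded_of_large lt hK X h)) as [g hg]. exists g; auto.
  - exists (fun x => x); tauto.
Qed.

(* If [A] is indexed by [K], some [f] eventually dominates the next-element
   function of every member of [A], and the intervals of one colour
   then split all of [A]. *)
Lemma unsplit_gt_kappa {K : Type} (lt : K -> K -> Prop)
  (hK : regular_infinite_cardinal K lt) (A : (K -> Prop) -> Prop) :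
  unsplit A -> ~ card_le A (full K).
Proof.
  intros [hA hns] [j [_ hj]].
  assert (hW := regular_wellorder lt hK). pose proof hW as [hwf [htr htot]].
  destruct (next_element lt hK) as [next hnext].
  (* At [b] only the fewer than $\kappa$ sets with code below [b] are treated, so a bound exists. *)
  assert (hf : forall b, exists y, forall B, A B /\ lt (j B) b -> lt (next B b) y).
  { intros b. apply (bounded_image lt hK (K -> Prop)). intros h.
    apply (proj2 (proj1 (proj2 (proj2 hK)) b)), (card_le_trans _ _ _ h).
    exists j; split; [tauto|]. intros x y [hx _] [hy _]; auto. }
  destruct (choice _ hf) as [f hf']. clear hf.
  destruct (interval_blocks lt hK f) as [idx [c [_ [_ [_ hblk]]]]].
  assert (key : forall v B, A B -> forall a, exists x,
    (c (idx x) = v /\ B x) /\ ~ lt x a).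
  { intros v B hB a. destruct (regular_no_max lt hK (j B)) as [j' hj'].
    destruct (wellorder_max lt hW a j') as [d [hd1 hd2]].
    destruct (hblk v d) as [b [hb1 [_ hb3]]].
    destruct (hnext B (hA B hB) b) as [h1 h2].
    exists (next B b). split; [split; [|exact h1]|].
    - apply hb3; [exact h2|]. apply hf'; split; [exact hB|].
      apply (wellorder_lt_le_trans lt hW _ j'); [exact hj'|].
      apply (wellorder_le_trans lt hW _ d); auto.
    - apply (wellorder_le_trans lt hW _ d); [auto|].
      apply (wellorder_le_trans lt hW _ b); auto. }
  apply hns. exists (fun z => c (idx z) = true). split; [|intros B hB; split].
  - apply (large_of_unbounded lt hK). intros a.
    destruct (hblk true a) as [b [hb1 [hb2 _]]]. eauto.
  - apply (large_of_unbounded lt hK), key, hB.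
  - apply (large_of_unbounded lt hK). intros a.
    destruct (key false B hB a) as [x [[h1 h2] h3]].
    exists x; repeat split; auto. congruence.
Qed.

(** * Ultrafilters *)

(** Either [S] or its complement is in [U] and so contains a member of the base, which [S] cannot
    split. *)
Lemma base_unsplit {K : Type} (U B : (K -> Prop) -> Prop) :
  inhabited K -> uniform_ultrafilter U -> base_of U B -> unsplit B.
Proof.
  intros [k] [[_ [_ [_ hU]]] hunif] [hB1 hB2]. split; [auto|].
  intros [S [_ hS]].
  assert (hempty : forall X : K -> Prop, (forall x, ~ X x) -> ~ large X).
  { intros X hX [e [he _]]. exact (hX (e k) (he k I)). }
  destruct (hU S) as [h|h]; destruct (hB2 _ h) as [Y [hY hYS]];
    destruct (hS Y hY) as [h1 h2].
  - revert h2. apply hempty. intros x [hx hx']. exact (hx' (hYS x hx)).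
  - revert h1. apply hempty. intros x [hx hx']. exact (hYS x hx' hx).
Qed.

(* Koppelberg's argument that a sigma-complete Boolean algebra is not the union
   of a strictly increasing sequence of subalgebras, for the subalgebras [C n]
   generated by the filters [F n]. *)
Lemma ultrafilter_union_chain {K : Type} (U : (K -> Prop) -> Prop)
  (F : nat -> (K -> Prop) -> Prop) :
  ultrafilter U ->
  (forall n X Y, F n X -> (forall x, X x -> Y x) -> F n Y) ->
  (forall n X Y, F n X -> F n Y -> F n (fun x => X x /\ Y x)) ->
  (forall n m X, n <= m -> F n X -> F m X) ->
  (forall n X, F n X -> U X) ->
  (forall X, U X -> exists n, F n X) ->
  exists n, forall X, U X -> F n X.
Proof.
  intros [_ [Uint [_ Uult]]] Fup Fint Fmono FU UF.
  apply NNPP; intros hno.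
  assert (hno' : forall n, exists Y, U Y /\ ~ F n Y).
  { intros n. apply NNPP; intros h. apply hno. exists n. intros X hX.
    apply NNPP; intros h'. apply h; eauto. }
  set (C := fun n S => F n S \/ F n (fun x => ~ S x)).
  assert (Cmono : forall n m S, n <= m -> C n S -> C m S).
  { intros n m S hnm [h|h]; [left|right]; eauto. }
  assert (Call : forall S, exists n, C n S).
  { intros S. destruct (Uult S) as [h|h]; apply UF in h; destruct h as [n hn];
      exists n; [left|right]; exact hn. }
  assert (Cint : forall n S S', C n S -> C n S' -> C n (fun x => S x /\ S' x)).
  { intros n S S' [h|h] [h'|h']; [left; auto|right..];
      [eapply (Fup n _ _ h')|eapply (Fup n _ _ h)|eapply (Fup n _ _ h)]; simpl; tauto. }
  assert (Cext : forall n S S', (forall x, S x <-> S' x) -> C n S -> C n S').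
  { intros n S S' e [h|h]; [left|right]; apply (Fup n _ _ h);
      intros x; specialize (e x); tauto. }
  assert (step : forall (k : nat) (X : {X | U X}), exists X' : {X | U X},
    (forall x, proj1_sig X' x -> proj1_sig X x) /\
    ~ C k (fun x => proj1_sig X x /\ ~ proj1_sig X' x)).
  { intros k [X hX]. destruct (UF X hX) as [m hm].
    destruct (hno' (max m k)) as [Y [hY hY']].
    exists (exist _ _ (Uint X Y hX hY)); simpl. split; [tauto|].
    intros [h|h].
    - apply FU in h. apply hno.
      destruct (UF _ (Uint _ _ (Uint X Y hX hY) h)) as [p hp].
      exists p. intros Z _. apply (Fup _ _ _ hp). tauto.
    - apply hY'.
      apply (Fup _ (fun x => X x /\ ~ (X x /\ ~ (X x /\ Y x)))).
      + apply Fint; [apply (Fmono m)|apply (Fmono k)]; auto; lia.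
      + intros x [h1 h2]. apply NNPP; tauto. }
  assert (step' : exists g : nat -> {X | U X} -> {X | U X}, forall k X,
    (forall x, proj1_sig (g k X) x -> proj1_sig X x) /\
    ~ C k (fun x => proj1_sig X x /\ ~ proj1_sig (g k X) x)).
  { apply (choice (fun k (gk : {X | U X} -> {X | U X}) => forall X,
      (forall x, proj1_sig (gk X) x -> proj1_sig X x) /\
      ~ C k (fun x => proj1_sig X x /\ ~ proj1_sig (gk X) x))).
    intros k. apply (choice _ (step k)). }
  destruct step' as [g hg].
  destruct (hno' 0) as [Y0 [hY0 _]].
  set (X := fix X k := match k with 0 => exist _ Y0 hY0 | S k => g k (X k) end).
  set (d := fun k x => proj1_sig (X k) x /\ ~ proj1_sig (X (S k)) x).
  assert (hd : forall k, ~ C k (d k)) by (intros k; apply (hg k (X k))).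
  assert (hX : forall i j x, i <= j -> proj1_sig (X j) x -> proj1_sig (X i) x).
  { induction 1 as [|j _ IH]; [auto|]. intros h. apply IH, (hg j (X j)), h. }
  assert (hdisj : forall i j x, d i x -> d j x -> i = j).
  { intros i j x [h1 h2] [h3 h4]. destruct (Nat.lt_trichotomy i j) as [h|[h|h]];
      [exfalso|exact h|exfalso].
    - apply h2, (hX (S i) j); auto.
    - apply h4, (hX (S j) i); auto. }
  clearbody d. clear X hX hg g step.
  (* The pairing arranges the disjoint sets [d] in columns with unions [a j]. From column [j] one
     set is selected whose index is at least both [j] and the stage [m j] deciding the column. *)
  set (a := fun j x => exists i, d (to_nat (j, i)) x).
  destruct (choice _ (fun j => Call (a j))) as [m hm].
  set (k := fun j => to_nat (j, max j (m j))).
  destruct (Call (fun x => exists j, d (k j) x)) as [p hp].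
  (* The union of the selected sets, decided at stage [p], meets column [p] exactly in [d (k p)],
     which is therefore decided too early. *)
  apply (hd (k p)). apply (Cmono (max p (m p))).
  { unfold k. pose proof (to_nat_non_decreasing p (max p (m p))). lia. }
  apply (Cext _ (fun x => (exists j, d (k j) x) /\ a p x)).
  - intros x; split.
    + intros [[j hj] [i hi]].
      assert (e := hdisj _ _ _ hj hi). apply to_nat_inj in e.
      inversion e; subst. exact hj.
    + intros h; split; [eauto|]. exists (max p (m p)); exact h.
  - apply Cint; [apply (Cmono p)|apply (Cmono (m p))]; auto; lia.
Qed.

(** * A uniform ultrafilter from a small unsplit family *)

(** [D] is too small to be dominating. A function exceeding some [h] only below a fixed [a] would be
    dominated by it, as segments are small. *)
Lemma unbounded_family {K : Type} (lt : K -> K -> Prop)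
  (hK : regular_infinite_cardinal K lt) (A : (K -> Prop) -> Prop)
  (hrd : forall D : (K -> K) -> Prop, dominating lt D -> card_lt A D)
  (D : (K -> K) -> Prop) :
  card_le D A ->
  exists f, forall h, D h -> forall a, exists b, lt (h b) (f b) /\ ~ lt b a.
Proof.
  intros hD. apply NNPP; intros hno.
  refine (proj2 (hrd D _) hD). intros f.
  apply NNPP; intros hf. apply hno. exists f. intros h hh a.
  apply NNPP; intros ha. apply hf. exists h; split; [exact hh|].
  assert (hs : forall b, lt (h b) (f b) -> lt b a).
  { intros b hb. apply NNPP; intros h'; eauto. }
  split; [apply card_le_sub; intros; exact I|].
  intros hl. apply (proj2 (proj1 (proj2 (proj2 hK)) a)).
  exact (card_le_trans _ _ _ hl (card_le_sub _ _ hs)).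
Qed.

(** Extends the property to sets [S] that are not large, where the first alternative holds; [A] is
    nonempty, as [full K] would split an empty family vacuously. *)
Lemma unsplit_decides {K : Type} (A : (K -> Prop) -> Prop) :
  unsplit A -> forall S : K -> Prop, exists B, A B /\
    (~ large (fun x => S x /\ B x) \/ ~ large (fun x => B x /\ ~ S x)).
Proof.
  intros [_ hns] S.
  assert (hA : exists B, A B /\ ~ (large S /\ splits S B)).
  { apply NNPP; intros hno.
    assert (hall : forall B, A B -> large S /\ splits S B).
    { intros B hB. apply NNPP; intros h; eauto. }
    destruct (classic (exists B, A B)) as [[B hB]|hemp].
    - apply hns. exists S; split; [apply (hall B hB)|]. intros; apply hall; auto.
    - apply hns. exists (full K); split; [apply card_le_sub; auto|].
      intros B hB; exfalso; eauto. }
  destruct hA as [B [hB h]]. exists B; split; [exact hB|].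
  destruct (classic (large S)) as [hS|hS].
  - apply not_and_or. intros h'. apply h; split; assumption.
  - left. intros h'. apply hS, (card_le_trans _ _ _ h'), card_le_sub. tauto.
Qed.

Lemma exists_ultrafilter_with_base_le {K : Type} (lt : K -> K -> Prop)
  (hK : regular_infinite_cardinal K lt) (A : (K -> Prop) -> Prop)
  (hA : unsplit A)
  (hrd : forall D : (K -> K) -> Prop, dominating lt D -> card_lt A D) :
  exists U B : (K -> Prop) -> Prop,
    uniform_ultrafilter U /\ base_of U B /\ card_le B A.
Proof.
  assert (hW := regular_wellorder lt hK). pose proof hW as [hwf [htr htot]].
  assert (hirr := wf_irrefl lt hwf).
  assert (le_le := wellorder_le_trans lt hW).
  assert (lt_w := wellorder_lt_le lt hW).
  assert (hKA : card_le (full K) A).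
  { destruct (card_le_total (full K) A (inhabits (full K))) as [h|h]; auto.
    destruct (unsplit_gt_kappa lt hK A hA h). }
  assert (hnat : card_le (full nat) A).
  { exact (card_le_trans _ _ _ (proj1 (proj2 hK)) hKA). }
  assert (hlists := card_le_lists A hnat).
  assert (he : exists e : (K -> Prop) -> K -> K, forall X, large X ->
    (forall x, X (e X x)) /\ forall x y, e X x = e X y -> x = y).
  { apply (choice (fun X (e : K -> K) => large X ->
      (forall x, X (e x)) /\ forall x y, e x = e y -> x = y)).
    intros X. destruct (classic (large X)) as [[e [e1 e2]]|h].
    - exists e. intros _; split; [intros; apply e1; exact I|].
      intros x y; apply e2; exact I.
    - exists (fun x => x); tauto. }
  destruct he as [e he].
  destruct (next_element lt hK) as [next hnext].
  set (img := fun (X B : K -> Prop) z => exists x, B x /\ z = e X x).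
  assert (himg : forall X B, large X -> large B -> large (img X B)).
  { intros X B hX hB. apply (card_le_trans _ _ _ hB).
    exists (e X); split; [intros x hx; exists x; auto|].
    intros x y _ _; apply he, hX. }
  (* The set [X] is chosen only after [f] and its intervals, so these majorants range over all pairs
     of a set and a finite list. *)
  assert (hh : exists h : (K -> Prop) * list (K -> Prop) -> K -> K,
    forall p b B, In B (snd p) -> lt (next (img (fst p) B) b) (h p b)).
  { apply (choice (fun (p : (K -> Prop) * list (K -> Prop)) (g : K -> K) =>
      forall b B, In B (snd p) -> lt (next (img (fst p) B) b) (g b))).
    intros p.
    apply (choice (fun b y => forall B, In B (snd p) -> lt (next (img (fst p) B) b) y)).
    intros b. apply (bounded_image lt hK (K -> Prop)).
    apply (listed_not_large lt hK). exists (snd p); auto. }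
  destruct hh as [h hh].
  destruct (unbounded_family lt hK A hrd
    (fun g => exists p, Forall A (fst p :: snd p) /\ h p = g)) as [f hf].
  { apply (card_le_trans _ _ _
      (card_le_surj (fun p => Forall A (fst p :: snd p)) _ h
         (inhabits (full K, [])) (fun g hg => hg))).
    refine (card_le_trans _ (Forall A) _ _ hlists).
    exists (fun p => fst p :: snd p); split; [auto|].
    intros [X l] [X' l'] _ _ E. simpl in E; congruence. }
  destruct (interval_blocks lt hK f) as [idx [c [idx_mono [idx_unb [hblk _]]]]].
  assert (hX : exists X v d, A X /\ forall z, X z -> ~ lt z d -> c (idx z) = v).
  { destruct (unsplit_decides A hA (fun z => c (idx z) = true)) as [X [hX hs]].
    exists X. destruct hs as [hs|hs];
      destruct (bounded_of_not_large lt hK _ hs) as [d hd].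
    - exists false, d; split; [exact hX|]. intros z hz hzd.
      destruct (c (idx z)) eqn:E; [exfalso; eauto|reflexivity].
    - exists true, d; split; [exact hX|]. intros z hz hzd.
      destruct (c (idx z)) eqn:E; [reflexivity|exfalso].
      apply hzd, hd. split; [exact hz|congruence]. }
  destruct hX as [X [v [d0 [hX hXv]]]].
  assert (hXl := proj1 hA X hX).
  (* The base of the filter: indices from a bound on of intervals met by every copy of a listed set.
     The bound lets bounded sets of indices be discarded. *)
  set (G := fun (q : list (K -> Prop) * K) a => ~ lt a (snd q) /\
    forall B, In B (fst q) -> exists z, img X B z /\ a = idx z).
  assert (hG : forall q, Forall A (fst q) -> large (G q)).
  { intros [l d] hl; simpl in hl. apply (large_of_unbounded lt hK). intros y.
    destruct (wellorder_max lt hW d y) as [m [hm1 hm2]].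
    destruct (idx_unb m) as [z0 hz0].
    destruct (wellorder_max lt hW z0 d0) as [t [ht1 ht2]].
    (* Here [f] exceeds the majorant, so every copy meets the window from [b]. Past [d0] these
       points all have colour [v], hence share one interval. *)
    destruct (hf (h (X, l))) with (a := t) as [b [hb1 hb2]].
    { exists (X, l); split; [|reflexivity]. constructor; auto. }
    set (z := fun B => next (img X B) b).
    assert (hz : forall B, In B l -> img X B (z B) /\ ~ lt (z B) b /\
      lt (z B) (f b) /\ c (idx (z B)) = v).
    { intros B hB. rewrite Forall_forall in hl.
      destruct (hnext (img X B) (himg X B hXl (proj1 hA B (hl B hB))) b) as [h1 h2].
      split; [exact h1|split; [exact h2|split]].
      - apply (htr _ (h (X, l) b)); [apply (hh (X, l)), hB|exact hb1].
      - apply hXv.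
        + destruct h1 as [x [_ E]]. unfold z; rewrite E. apply he, hXl.
        + apply (le_le _ t); [auto|]. apply (le_le _ b); auto. }
    assert (ha : exists w, ~ lt w b /\ forall B, In B l -> idx w = idx (z B)).
    { destruct l as [|B0 l].
      - exists b; split; [auto|intros B []].
      - exists (z B0); split; [apply hz; left; auto|]. intros B hB.
        destruct (hz B0 (or_introl eq_refl)) as [_ [h1 [h2 h3]]].
        destruct (hz B hB) as [_ [h4 [h5 h6]]].
        apply (hblk b); congruence || auto. }
    destruct ha as [w [hw1 hw2]]. exists (idx w).
    assert (hmw : ~ lt (idx w) m).
    { apply lt_w, hz0. apply (le_le _ t); [auto|]. apply (le_le _ b); auto. }
    split; [split|].
    - apply (le_le _ m); auto.
    - simpl. intros B hB. exists (z B); split; [apply hz, hB|apply hw2, hB].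
    - apply (le_le _ m); auto. }
  exists (fun S => exists q, Forall A (fst q) /\ forall a, G q a -> S a).
  exists (fun S => exists q, Forall A (fst q) /\ G q = S).
  split; [split; [split; [|split; [|split]]|]|split; [split|]].
  - intros S S' [q [hq1 hq2]] hSS'. exists q; auto.
  - intros S S' [[l d] [hl hS]] [[l' d'] [hl' hS']].
    destruct (wellorder_max lt hW d d') as [m [hm1 hm2]].
    exists (l ++ l', m); split; [apply Forall_app; auto|].
    intros a [ha1 ha2]; simpl in *. split.
    + apply hS; split; [apply (le_le _ m); auto|].
      intros B hB. apply ha2, in_or_app; auto.
    + apply hS'; split; [apply (le_le _ m); auto|].
      intros B hB. apply ha2, in_or_app; auto.
  - intros [q [hq1 hq2]].
    destruct (unbounded_of_large lt hK _ (hG q hq1) (snd q)) as [x [hx _]].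
    exact (hq2 x hx).
  - intros S.
    (* Pull [S] back along copying and collapsing. Some [B] decides the preimage up to a small set,
       and [d'] cuts off the indices of the exceptions. *)
    destruct (unsplit_decides A hA (fun x => S (idx (e X x)))) as [B [hB hs]].
    assert (key : forall P : K -> Prop, ~ large (fun x => B x /\ P (idx (e X x))) ->
      exists q, Forall A (fst q) /\ forall a, G q a -> ~ P a).
    { intros P hP.
      destruct (bounded_image lt hK K _ (e X) hP) as [d hd].
      destruct (regular_no_max lt hK (idx d)) as [d' hd'].
      exists ([B], d'); split; [simpl; auto|].
      intros a [ha1 ha2] hPa. simpl in *.
      destruct (ha2 B (or_introl eq_refl)) as [z [[x [hx ->]] ->]].
      apply ha1. refine (wellorder_le_lt_trans lt hW _ _ _ _ hd').
      apply idx_mono, lt_w, hd. split; assumption. }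
    destruct hs as [hs|hs].
    + right. apply key. intros h'. apply hs, (card_le_trans _ _ _ h'), card_le_sub.
      tauto.
    + left. destruct (key (fun a => ~ S a) hs) as [q [hq1 hq2]].
      exists q; split; [exact hq1|]. intros a ha. apply NNPP, hq2, ha.
  - intros S [q [hq1 hq2]].
    exact (card_le_trans _ _ _ (hG q hq1) (card_le_sub _ _ hq2)).
  - intros S [q [hq1 hq2]]. exists q; split; [exact hq1|]. subst S; auto.
  - intros S [q [hq1 hq2]]. exists (G q); split; [exists q; auto|exact hq2].
  - destruct (regular_inhabited lt hK) as [k].
    apply (card_le_trans _ _ _
      (card_le_surj (fun q => Forall A (fst q)) _ G
         (inhabits ([], k)) (fun g hg => hg))).
    refine (card_le_trans _ (square A) _ _ (card_le_square A hnat)).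
    destruct hlists as [u [u1 u2]], hKA as [w [w1 w2]].
    exists (fun q => (u (fst q), w (snd q))); split.
    + intros [l d] hl. split; simpl; [auto|]. apply w1; exact I.
    + intros [l d] [l' d'] hl hl' E; simpl in *. inversion E.
      f_equal; [apply u2|apply w2]; auto; exact I.
Qed.

(** * Lower bound for bases and the cofinality of $\mathfrak{r}_\kappa$ *)

Lemma base_card_ge {K : Type} (A : (K -> Prop) -> Prop) (hI : inhabited K)
  (hA : reaping_witness A) (U B : (K -> Prop) -> Prop) :
  uniform_ultrafilter U -> base_of U B -> card_le A B.
Proof. intros hU hB. apply (proj2 hA), (base_unsplit U B); auto. Qed.

(** Lists over an infinite [Y] are no more numerous than [Y]; otherwise there are only countably
    many. *)
Lemma lists_small {T V : Type} (A : T -> Prop) (Y : V -> Prop) :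
  ~ card_le A (full nat) -> ~ card_le A Y -> ~ card_le A (Forall Y).
Proof.
  intros hA hY h.
  destruct (classic (card_le (full nat) Y)) as [hn|hn].
  - exact (hY (card_le_trans _ _ _ h (card_le_lists Y hn))).
  - destruct (card_le_total Y (full nat) (inhabits 0)) as [hn'|hn']; [|tauto].
    apply hA, (card_le_trans _ _ _ h),
      (card_le_trans _ _ _ (card_le_lists_mono _ _ hn')), card_le_lists.
    apply card_le_sub; auto.
Qed.

(** A countable cofinal sequence would cut the base into increasing pieces. The filters they
    generate exhaust [U], so one of them is [U], which yields a base smaller than [A]. *)
Lemma reaping_cf_gt_omega {K : Type} (lt : K -> K -> Prop)
  (hK : regular_infinite_cardinal K lt) (A : (K -> Prop) -> Prop)
  (hA : reaping_witness A) (U B : (K -> Prop) -> Prop) :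
  uniform_ultrafilter U -> base_of U B -> card_le B A -> cf_gt_omega A.
Proof.
  intros hU hB [j [j1 j2]].
  assert (hI := regular_inhabited lt hK).
  assert (hnat : ~ card_le A (full nat)).
  { intros h. apply (unsplit_gt_kappa lt hK A (proj1 hA)).
    exact (card_le_trans _ _ _ h (proj1 (proj2 hK))). }
  destruct (initial_wo A) as [R [hR hseg]].
  exists R; split; [exact hR|split].
  { intros a ha. split; [apply card_le_sub; tauto|apply hseg, ha]. }
  intros s hs. apply NNPP; intros hcof.
  destruct hR as [Rirr [Rtr [Rtot _]]].
  (* The points of [A] at or below the largest of [s 0] to [s n]. *)
  set (An := fun n a => A a /\ exists i, i <= n /\ ~ R (s i) a).
  assert (hAn : forall n, ~ card_le A (Forall (An n))).
  { intros n. apply lists_small; [exact hnat|].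
    assert (ht : exists t, A t /\ forall a, An n a -> ~ R t a).
    { induction n as [|n [t [ht1 ht2]]].
      - exists (s 0); split; [apply hs|]. intros a [ha [i [hi h]]].
        replace i with 0 in h by lia. exact h.
      - destruct (classic (R t (s (S n)))) as [h|h].
        + exists (s (S n)); split; [apply hs|]. intros a [ha [i [hi h']]] h''.
          destruct (Nat.eq_dec i (S n)) as [->|hne]; [exact (h' h'')|].
          apply (ht2 a); [split; [exact ha|exists i; split; [lia|exact h']]|].
          exact (Rtr _ _ _ ht1 (hs (S n)) ha h h'').
        + exists t; split; [exact ht1|]. intros a [ha [i [hi h']]] h''.
          destruct (Nat.eq_dec i (S n)) as [->|hne].
          * destruct (Rtot t (s (S n)) ht1 (hs _)) as [h3|[h3|h3]];
              [exact (h h3)|congruence|].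
            exact (h' (Rtr _ _ _ (hs _) ht1 ha h3 h'')).
          * apply (ht2 a); [split; [exact ha|exists i; split; [lia|exact h']]|].
            exact h''. }
    destruct ht as [t [ht1 ht2]]. intros h.
    apply (lists_small A (fun x => A x /\ R x t) hnat (hseg t ht1)).
    apply (card_le_trans _ _ _ h).
    (* The maximum [t] goes to the empty list, so only points strictly below [t] enter the lists. *)
    exists (fun a => if excluded_middle_informative (a = t) then [] else [a]).
    split.
    - intros a ha. destruct (excluded_middle_informative (a = t)) as [_|hne]; auto.
      constructor; [|auto]. split; [apply ha|].
      destruct (Rtot a t (proj1 ha) ht1) as [h'|[h'|h']]; [auto|tauto|].
      destruct (ht2 a ha h').
    - intros a b _ _.
      destruct (excluded_middle_informative (a = t)),
        (excluded_middle_informative (b = t)); congruence. }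
  set (meet := fun (l : list (K -> Prop)) x => forall Y, In Y l -> Y x).
  set (Bn := fun n Y => B Y /\ An n (j Y)).
  assert (hmeet : forall n l, Forall (Bn n) l -> U (meet l)).
  { destruct hU as [[Uup [Uint [_ Uult]]] _].
    induction 1 as [|Y l hY _ IH].
    - destruct (Uult (fun _ => True)) as [h|h]; apply (Uup _ _ h); intros x _ Z [].
    - apply (Uup (fun x => Y x /\ meet l x)).
      + apply Uint; [apply (proj1 hB), hY|exact IH].
      + intros x [h1 h2] Z [<-|hZ]; [exact h1|exact (h2 Z hZ)]. }
  destruct (ultrafilter_union_chain U
    (fun n S => exists l, Forall (Bn n) l /\ forall x, meet l x -> S x))
    as [n hn].
  - exact (proj1 hU).
  - intros n S S' [l [hl1 hl2]] h. exists l; auto.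
  - intros n S S' [l [hl1 hl2]] [l' [hl1' hl2']].
    exists (l ++ l'); split; [apply Forall_app; auto|].
    intros x hx. split; [apply hl2|apply hl2'];
      intros Y hY; apply hx, in_or_app; auto.
  - intros n m S hnm [l [hl1 hl2]]. exists l; split; [|exact hl2].
    revert hl1. apply Forall_impl. intros Y [hY1 [hY2 [i [hi1 hi2]]]].
    split; [exact hY1|split; [exact hY2|]]. exists i; split; [lia|exact hi2].
  - intros n S [l [hl1 hl2]].
    exact (proj1 (proj1 hU) _ _ (hmeet n l hl1) hl2).
  - intros S hS. destruct (proj2 hB S hS) as [Y [hY hYS]].
    assert (hi : exists i, ~ R (s i) (j Y)).
    { apply NNPP; intros h. apply hcof. exists (j Y); split; [auto|].
      intros i. apply NNPP; eauto. }
    destruct hi as [i hi]. exists i, [Y]; split.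
    + constructor; [|auto]. split; [exact hY|split; [auto|]]. exists i; auto.
    + intros x hx. apply hYS, hx. left; reflexivity.
  (* Finite meets from [Bn n] now form a base of [U], so minimality of [A] embeds it in the lists
     over [An n]. *)
  - apply (hAn n).
    apply (card_le_trans _ (fun S => exists l, Forall (Bn n) l /\ meet l = S)).
    + apply (base_card_ge A hI hA U); [exact hU|split].
      * intros S [l [hl <-]]. exact (hmeet n l hl).
      * intros S hS. destruct (hn S hS) as [l [hl1 hl2]]. eauto.
    + apply (card_le_trans _ (Forall (Bn n))).
      * apply (card_le_surj _ _ meet (inhabits [])).
        intros S hS; exact hS.
      * apply card_le_lists_mono. exists j; split; [intros Y hY; apply hY|].
        intros Y Y' hY hY'. apply j2; [apply hY|apply hY'].
Qed.

(* A is a witness for r_kappa (unsplit of minimal size).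
   Hypothesis: r_kappa < d_kappa.
   Conclusion: u_kappa <= r_kappa (some uniform ultrafilter has a base of size
   <= |A|), r_kappa <= u_kappa (every base of a uniform ultrafilter has size
   >= |A|), and cf(r_kappa) > omega. *)
Theorem theorem2p10 (K : Type) (lt : K -> K -> Prop)
  (hK : regular_infinite_cardinal K lt)
  (A : (K -> Prop) -> Prop) (hA : reaping_witness A)
  (hrd : forall D : (K -> K) -> Prop, dominating lt D -> card_lt A D) :
  ((exists U B : (K -> Prop) -> Prop,
       uniform_ultrafilter U /\ base_of U B /\ card_le B A) /\
   (forall U B : (K -> Prop) -> Prop,
       uniform_ultrafilter U -> base_of U B -> card_le A B)) /\
  cf_gt_omega A.
Proof.
  pose proof (exists_ultrafilter_with_base_le lt hK A (proj1 hA) hrd) as hU.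
  split; [split|].
  - exact hU.
  - exact (fun U B => base_card_ge A (regular_inhabited lt hK) hA U B).
  - destruct hU as [U [B [hU [hB hBA]]]].
    exact (reaping_cf_gt_omega lt hK A hA U B hU hB hBA).
Qed.
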